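(* Let $f:\mathcal D\subset\Omega\times(0,\infty)\to\Omega\times(0,\infty)$ be a measure-preserving embedding of the form $f(\omega,r)=(\omega+\psi(F(\omega,r)),\,r+G(\omega,r))$ with $F,G:\mathcal D\to\mathbb R$ continuous. Suppose there is a function $W\in\mathcal C^1_\psi(\Omega\times(0,\infty))$ and constants $\beta,\delta>0$ with $$0<\beta\le\partial_rW(\omega,r)\le\delta\quad\text{for all }\omega\in\Omega,\ r\in(0,\infty),$$ and $$W(f(\omega,r))\le W(\omega,r)+k(r)\quad\text{for all }(\omega,r)\in\mathcal D,$$ where $k:(0,\infty)\to\mathbb R$ is decreasing, bounded and satisfies $\lim_{r\to\infty}k(r)=0$. Then for $\mu_\Omega$-almost every $\omega\in\Omega$ the set $E_\omega\subset\mathbb R\times(0,\infty)$ has two-dimensional Lebesgue measure zero.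
   Context: $\Omega$ is a commutative (written additively), compact, metrizable topological group, and $\psi:\mathbb R\to\Omega$ is a continuous group homomorphism with $\psi(\mathbb R)$ dense in $\Omega$. $\mu_\Omega$ is the Haar probability measure of $\Omega$, $\lambda$ is Lebesgue measure on $\mathbb R$, $\lambda^2$ on $\mathbb R^2$. For $U:\Omega\to\mathbb R$ set $\partial_\psi U(\omega)=\lim_{t\to0}\frac{U(\omega+\psi(t))-U(\omega)}{t}$; $\mathcal C^1_\psi(\Omega)$ is the space of continuous $U$ for which $\partial_\psi U$ exists at every point and is continuous on $\Omega$. $\mathcal C^1_\psi(\Omega\times(0,\infty))$ denotes the functions $W(\omega,r)$ with $W(\cdot,r)\in\mathcal C^1_\psi(\Omega)$ for every $r$ and $W(\omega,\cdot)\in\mathcal C^1(0,\infty)$ for every $\omega$. A map $f:\mathcal D\to\Omega\times(0,\infty)$ with $\mathcal D\subset\Omega\times(0,\infty)$ open is a measure-preserving embedding if it is continuous, injective and $(\mu_\Omega\otimes\lambda)(f(\mathcal B))=(\mu_\Omega\otimes\lambda)(\mathcal B)$ for all Borel $\mathcal B\subset\mathcal D$. For $\omega\in\Omega$ let $\psi_\omega(t)=\omega+\psi(t)$, $D_\omega=\{(t,r)\in\mathbb R\times(0,\infty):(\psi_\omega(t),r)\in\mathcal D\}$ and $f_\omega:D_\omega\to\mathbb R\times(0,\infty)$, $f_\omega(t,r)=(t+F(\psi_\omega(t),r),\,r+G(\psi_\omega(t),r))$. Set $D_{\omega,1}=D_\omega$, $D_{\omega,n+1}=f_\omega^{-1}(D_{\omega,n})$,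 $D_{\omega,\infty}=\bigcap_{n\ge1}D_{\omega,n}$, and for $(t_0,r_0)\in D_{\omega,\infty}$ write $(t_n,r_n)=f_\omega^n(t_0,r_0)$. The escaping set is $E_\omega=\{(t_0,r_0)\in D_{\omega,\infty}:\lim_{n\to\infty}r_n=\infty\}$. *)

(* Defs.v *)
From HB Require Import structures.
From mathcomp Require Import all_boot all_order all_algebra.
From mathcomp Require Import all_classical all_reals all_analysis.
Set Implicit Arguments. Unset Strict Implicit. Unset Printing Implicit Defensive.
Import Order.TTheory GRing.Theory Num.Theory.
Import numFieldNormedType.Exports.
Local Open Scope classical_set_scope.
Local Open Scope ring_scope.

Definition metrizable (R : realType) (T : topologicalType) : Prop :=
  exists d : T -> T -> R,
    [/\ (forall x y, 0 <= d x y),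
        (forall x y, d x y = 0 <-> x = y),
        (forall x y, d x y = d y x),
        (forall x y z, d x z <= d x y + d y z) &
        (forall A : set T, open A <->
           (forall x, A x -> exists2 e, 0 < e & [set y | d x y < e] `<=` A))].

(* The Borel measurable space of a topological abelian group
   (pointed by 0, as required by the library's g_sigma_algebraType). *)
Definition gpt (Om : topologicalZmodType) : Type := Om.
HB.instance Definition _ (Om : topologicalZmodType) :=
  Topological.on (gpt Om).
HB.instance Definition _ (Om : topologicalZmodType) :=
  isPointed.Build (gpt Om) (0 : Om).
Definition borel_of (Om : topologicalZmodType) : measurableType _ :=
  g_sigma_algebraType (@open (gpt Om)).

Definition haar_probability (R : realType) (Om : topologicalZmodType)
    (mu : probability (borel_of Om) R) : Prop :=
  forall (a : Om) (A : set Om), measurable (A : set (borel_of Om)) ->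
    mu ((fun x : Om => a + x) @` A : set (borel_of Om)) = mu (A : set (borel_of Om)).

Definition dpsi (R : realType) (Om : topologicalZmodType) (psi : R -> Om)
    (U : Om -> R) (w : Om) : R :=
  derive1 (fun t : R => U (w + psi t)) 0.

Definition C1psi (R : realType) (Om : topologicalZmodType) (psi : R -> Om)
    (U : Om -> R) : Prop :=
  [/\ continuous U,
      (forall w : Om, derivable (fun t : R => U (w + psi t)) 0 1) &
      continuous (dpsi psi U)].

(* The class C^1_psi(Omega x (0,oo)) ; W is given as a function on Omega x R,
   only its values for r > 0 matter. *)
Definition C1psi_half (R : realType) (Om : topologicalZmodType) (psi : R -> Om)
    (W : Om -> R -> R) : Prop :=
  (forall r : R, 0 < r -> C1psi psi (fun w => W w r)) /\
  (forall w : Om, (forall r : R, 0 < r -> derivable (W w) r 1) /\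
     {within `]0, +oo[, continuous (derive1 (W w))}).

Definition flowmap (R : realType) (Om : topologicalZmodType) (psi : R -> Om)
    (F G : Om * R -> R) (p : Om * R) : Om * R :=
  (p.1 + psi (F p), p.2 + G p).

Definition Dfib (R : realType) (Om : topologicalZmodType) (psi : R -> Om)
    (D : set (Om * R)) (w : Om) : set (R * R) :=
  [set p | D (w + psi p.1, p.2)].

Definition ffib (R : realType) (Om : topologicalZmodType) (psi : R -> Om)
    (F G : Om * R -> R) (w : Om) (p : R * R) : R * R :=
  (p.1 + F (w + psi p.1, p.2), p.2 + G (w + psi p.1, p.2)).

Definition Dinf (R : realType) (Om : topologicalZmodType) (psi : R -> Om)
    (D : set (Om * R)) (F G : Om * R -> R) (w : Om) : set (R * R) :=
  [set p | forall n : nat, Dfib psi D w (iter n (ffib psi F G w) p)].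

Definition escaping (R : realType) (Om : topologicalZmodType) (psi : R -> Om)
    (D : set (Om * R)) (F G : Om * R -> R) (w : Om) : set (R * R) :=
  [set p | Dinf psi D F G w p /\
           ((fun n : nat => (iter n (ffib psi F G w) p).2) @ \oo --> +oo)].

(* Main.v *)
Require Import Defs.
From HB Require Import structures.
From mathcomp Require Import all_boot all_order all_algebra finmap.
From mathcomp Require Import all_classical all_reals all_analysis measurable_realfun.
Set Implicit Arguments. Unset Strict Implicit. Unset Printing Implicit Defensive.
Import Order.TTheory GRing.Theory Num.Theory.
Import numFieldNormedType.Exports.
Local Open Scope classical_set_scope.
Local Open Scope ring_scope.

(** Call a point of the escaping set "last below h" if it has height W < h and
    all its later iterates have height >= h. An escaping orbit that starts below
    h meets this set L_h exactly once. Hence, for h0 <= h, sending a point of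
    L_h0 to the point of its orbit in L_h is injective and piecewise an iterate
    of f, so that m(L_h0) <= m(L_h). A point of L_h is about to cross the level
    h with a jump at most k(r), so L_h lies in a strip h - eps <= W < h with
    eps -> 0 as h -> oo; as the r-derivative of W is at least beta, this strip
    has measure at most eps / beta. Thus m(L_h) = 0 for every h, and the escaping
    set, a countable union of preimages of such sets, is null in Omega x (0,oo).
    Translation invariance of mu and Tonelli transfer this to almost all the
    sets E_w. *)

(** * Last visits below a level *)

Section last_visit.
Context (d : measure_display) (T : measurableType d) (R : realType).
Context (m : {measure set T -> \bar R}) (D : set T) (f : T -> T) (V : T -> R).
Hypothesis mD : measurable D.
Hypothesis mf : forall B, measurable B -> measurable (D `&` f @^-1` B).
Hypothesis f_inj : {in D &, injective f}.
Hypothesis f_mp : forall B, measurable B -> B `<=` D ->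
  measurable (f @` B) /\ m (f @` B) = m B.
Hypothesis mV : forall h, measurable (D `&` [set x | V x < h]).

Definition forever : set T := [set x | forall n, D (iter n f x)].

(** Escape is measured by the height [V], and only natural thresholds occur, so that the set is
    built from measurable ones by countable operations. *)
Definition unbounded_escape : set T := forever `&`
  [set x | forall h : nat, exists N : nat, forall n, (N <= n)%N ->
    h%:R <= V (iter n f x)].

Definition last_below (h : R) : set T := unbounded_escape `&`
  [set x | V x < h /\ forall n, h <= V (iter n.+1 f x)].

Lemma forever_iter n x : forever x -> forever (iter n f x).
Proof. by move=> xD k; rewrite -iterD. Qed.

Lemma unbounded_escape_iter n x :
  unbounded_escape x -> unbounded_escape (iter n f x).
Proof.
move=> [xD xV]; split; first exact: forever_iter.
move=> h; have [N hN] := xV h; exists N => k Nk.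
by rewrite -iterD; apply: hN; rewrite (leq_trans Nk)// leq_addr.
Qed.

Lemma iter_inj_forever n : {in forever &, injective (iter n f)}.
Proof.
elim: n => [//|n IH] x y; rewrite !inE => xD yD; rewrite /= => /f_inj xy.
by apply: IH; rewrite ?inE//; apply: xy; rewrite inE; [exact: xD|exact: yD].
Qed.

Lemma iter_image_measure n B : measurable B -> B `<=` forever ->
  measurable (iter n f @` B) /\ m (iter n f @` B) = m B.
Proof.
move=> mB BD; elim: n => [|n [mI IH]]; first by rewrite /= image_id.
have -> : iter n.+1 f @` B = f @` (iter n f @` B) by rewrite -image_comp.
have [|mfI ->] := f_mp mI; last by [].
by move=> _ [x Bx <-]; exact: BD.
Qed.

(** Since [mf] controls [f] on [D] only, the set records that the first [n] points of the orbit lie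
    in [D]. Peeling off the first step of the orbit then turns stage [n.+1] into the preimage of
    stage [n]. *)
Lemma measurable_iter_preimage n B : measurable B ->
  measurable [set x | (forall k, (k < n)%N -> D (iter k f x)) /\ B (iter n f x)].
Proof.
move=> mB; elim: n => [|n IH].
  by rewrite [X in measurable X](_ : _ = B)//; apply/seteqP; split=> [x []|x].
rewrite [X in measurable X](_ : _ = D `&` f @^-1`
  [set x | (forall k, (k < n)%N -> D (iter k f x)) /\ B (iter n f x)]).
  exact: mf.
apply/seteqP; split=> x /=.
  rewrite -iterS iterSr => -[xD xB]; split; first exact: (xD 0%N).
  by split=> // k kn; have := xD k.+1; rewrite ltnS iterSr; exact.
move=> [x0 [xD xB]]; rewrite -iterS iterSr; split=> // -[//|k] kn.
by rewrite iterSr; exact: xD.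
Qed.

Lemma measurable_forever : measurable forever.
Proof.
rewrite [forever](_ : _ = \bigcap_n [set x |
    (forall k, (k < n)%N -> D (iter k f x)) /\ D (iter n f x)]).
  by apply: bigcapT_measurable => n; exact: measurable_iter_preimage.
apply/seteqP; split=> [x xD n _|x xD n]; last by have [] := xD n I.
by split=> // k _; exact: xD.
Qed.

Lemma measurable_forever_iter n B : measurable B ->
  measurable (forever `&` [set x | B (iter n f x)]).
Proof.
move=> mB; rewrite [X in measurable X](_ : _ = forever `&` [set x |
    (forall k, (k < n)%N -> D (iter k f x)) /\ B (iter n f x)]).
  by apply: measurableI; [exact: measurable_forever|exact: measurable_iter_preimage].
by apply/seteqP; split=> x [xD xB]; split=> //; case: xB.
Qed.

Lemma measurable_forever_iter_lt n h :
  measurable (forever `&` [set x | V (iter n f x) < h]).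
Proof.
rewrite [X in measurable X](_ : _ = forever `&`
    [set x | (D `&` [set x | V x < h]) (iter n f x)]).
  exact: measurable_forever_iter.
apply/seteqP; split=> x [xD xV]; split=> //; by case: xV.
Qed.

Lemma measurable_forever_iter_ge n h :
  measurable (forever `&` [set x | h <= V (iter n f x)]).
Proof.
rewrite [X in measurable X](_ : _ = forever `\`
    (forever `&` [set x | V (iter n f x) < h])).
  by apply: measurableD; [exact: measurable_forever|exact: measurable_forever_iter_lt].
apply/seteqP; split=> x [xD xV]; split=> //=.
  by move=> -[_]; rewrite ltNge; move/negP; apply.
by rewrite leNgt; apply/negP => ?; exact: xV.
Qed.

Lemma measurable_unbounded_escape : measurable unbounded_escape.
Proof.
rewrite [unbounded_escape](_ : _ = \bigcap_(h : nat) \bigcup_(N : nat)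
    \bigcap_(n : nat) (forever `&` [set x | h%:R <= V (iter (n + N) f x)])).
  apply: bigcapT_measurable => h; apply: bigcupT_measurable => N.
  by apply: bigcapT_measurable => n; exact: measurable_forever_iter_ge.
apply/seteqP; split=> [x [xD xV] h _|x xV].
  have [N hN] := xV h; exists N => // n _; split=> //=.
  by apply: hN; rewrite leq_addl.
split; first by have [N _ /(_ 0%N I) []] := xV 0%N I.
move=> h; have [N _ hN] := xV h I; exists N => n Nn.
by have [_] := hN (n - N)%N I; rewrite /= subnK.
Qed.

Lemma measurable_last_below h : measurable (last_below h).
Proof.
rewrite [last_below h](_ : _ = unbounded_escape `&`
   ((forever `&` [set x | V (iter 0 f x) < h]) `&`
    \bigcap_n (forever `&` [set x | h <= V (iter n.+1 f x)]))).
  apply: measurableI; first exact: measurable_unbounded_escape.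
  apply: measurableI; first exact: measurable_forever_iter_lt.
  by apply: bigcapT_measurable => n; exact: measurable_forever_iter_ge.
apply/seteqP; split=> x [xE [xV xn]]; split=> //.
  have xD := xE.1; split; first by split.
  by move=> n _; split=> //; exact: xn.
by split; [exact: xV.2|move=> n; have [] := xn n I].
Qed.

Lemma reach_last_below h x : unbounded_escape x -> V x < h ->
  exists n, last_below h (iter n f x).
Proof.
move=> xE xh; have [_ xV] := xE.
have [N hN] := xV (Num.truncn h).+1.
(* Escape bounds the times at which the orbit is below [h]; the largest such time is the last
   visit. *)
pose P n := V (iter n f x) < h.
have P0 : exists n, P n by exists 0%N.
have PN n : P n -> (n <= N)%N.
  move=> Pn; rewrite leqNgt; apply/negP => Nn.
  have := hN n (ltnW Nn); rewrite leNgt => /negP; apply.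
  by rewrite (lt_trans Pn)// truncnS_gt.
have [n Pn nmax] := ex_maxnP P0 PN.
exists n; split; first exact: unbounded_escape_iter.
split=> [//|k]; rewrite leNgt -iterD; apply/negP => /nmax.
by rewrite addSn ltnNge leq_addl.
Qed.

Lemma last_below_le h0 h : h0 <= h -> (m (last_below h0) <= m (last_below h))%E.
Proof.
move=> h0h.
(* The pieces of the injection: on [A n] the orbit needs exactly [n] steps to its last visit below
   [h]. *)
pose A n := last_below h0 `&` (forever `&` [set x | last_below h (iter n f x)]).
have mA n : measurable (A n).
  apply: measurableI; first exact: measurable_last_below.
  exact/measurable_forever_iter/measurable_last_below.
have AD n : A n `<=` forever by move=> x [_ []].
have last_lt g x n k : last_below g (iter n f x) -> (n < k)%N ->
    g <= V (iter k f x).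
  move=> [_ [_ /(_ (k - n.+1)%N)]]; rewrite -iterD addSnnS => + nk.
  by rewrite subnK.
have tA : trivIset setT A.
  apply/trivIsetP => i j _ _ ij; apply/seteqP; split=> // x [[_ [_ xi]] [_ [_ xj]]].
  wlog lij : i j ij xi xj / (i < j)%N.
    move=> H; move: (ij); rewrite neq_ltn => /orP[/(H _ _ ij xi xj)//|].
    by apply: (H _ _ _ xj xi); rewrite eq_sym.
  have := last_lt _ _ _ _ xi lij; rewrite leNgt => /negP; apply.
  by case: xj => _ [].
(* If images of [x] and [y] after [i < j] steps agree, injectivity makes [x] a strictly later
   iterate of [y]. Then [x] has height at least [h0], as [y] was last below [h0], whereas [x] itself
   lies below [h0]. *)
have tfA : trivIset setT (fun n => iter n f @` A n).
  apply/trivIsetP => i j _ _ ij; apply/seteqP; split=> // z [[x Ax xz] [y Ay yz]].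
  wlog lij : i j x y ij Ax Ay xz yz / (i < j)%N.
    move=> H; move: (ij); rewrite neq_ltn => /orP[/(H _ _ _ _ ij Ax Ay xz yz)//|].
    by apply: (H _ _ _ _ _ Ay Ax yz xz); rewrite eq_sym.
  have xy : x = iter (j - i)%N f y.
    apply: (@iter_inj_forever i); rewrite ?inE; first exact: AD Ax.
      exact/forever_iter/(AD _ _ Ay).
    by rewrite -iterD subnKC ?(ltnW lij)// xz.
  have : h0 <= V (iter (j - i)%N f y).
    by apply: (@last_lt h0 y 0%N); [case: Ay|rewrite subn_gt0].
  by rewrite -xy leNgt => /negP; apply; case: Ax => -[_ []].
have -> : last_below h0 = \bigcup_n A n.
  apply/seteqP; split=> [x xL|x [n _ []]//].
  have [|n nL] := @reach_last_below h x xL.1.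
    by rewrite (lt_le_trans _ h0h)//; case: xL => _ [].
  by exists n => //; split=> //; split=> //; case: xL => -[].
have mfA n := (iter_image_measure n (mA n) (AD n)).1.
have eA n := (iter_image_measure n (mA n) (AD n)).2.
rewrite measure_bigcup// -(eq_eseriesr (fun n _ => eA n)).
rewrite -measure_bigcup//; apply: le_measure; rewrite ?inE.
- exact: bigcupT_measurable.
- exact: measurable_last_below.
- by move=> _ [n _ [x [_ [_ xL]] <-]].
Qed.

Hypothesis thin_crossing : forall e : R, 0 < e -> exists H : R, forall h,
  H <= h -> forall A, measurable A ->
    A `<=` D `&` [set x | V x < h <= V (f x)] -> (m A <= e%:E)%E.

Lemma last_below_null h : m (last_below h) = 0%E.
Proof.
apply/eqP; rewrite eq_le measure_ge0 andbT; apply/lee_addgt0Pr => e e0.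
have [H Hh] := thin_crossing e0; rewrite add0e.
(* Monotonicity allows the level to be raised past [H], where crossings are thin; a point of
   [last_below] crosses its level at the very next step. *)
apply: (@le_trans _ _ (m (last_below (Num.max h H)))).
  by apply: last_below_le; rewrite le_max lexx.
apply: (Hh (Num.max h H)); first by rewrite le_max lexx orbT.
  exact: measurable_last_below.
move=> x [[xD _] [xh xn]]; split; first exact: (xD 0%N).
by apply/andP; split=> //; exact: (xn 0%N).
Qed.

Lemma unbounded_escape_null : m unbounded_escape = 0%E.
Proof.
pose A (h n : nat) := unbounded_escape `&`
  (forever `&` [set x | last_below h%:R (iter n f x)]).
have mA h n : measurable (A h n).
  apply: measurableI; first exact: measurable_unbounded_escape.
  exact/measurable_forever_iter/measurable_last_below.
apply: (measure_negligible measurable_unbounded_escape).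
apply: (@negligibleS _ _ _ _ (\bigcup_h \bigcup_n A h n)).
  move=> x xE; have [n nL] := reach_last_below xE (truncnS_gt (V x)).
  by exists (Num.truncn (V x)).+1 => //; exists n => //; split=> //; case: xE.
apply: negligible_bigcup => h; apply: negligible_bigcup => n.
apply/negligibleP => //; have AD : A h n `<=` forever by move=> x [_ []].
have [mI mAI] := iter_image_measure n (mA h n) AD.
(* The [n]-th iterate preserves the measure of [A h n] and carries it into the null set
   [last_below h%:R]. *)
apply: (eq_trans (esym mAI)); apply/eqP.
rewrite eq_le measure_ge0 andbT -(last_below_null h%:R).
apply: le_measure; rewrite ?inE//; first exact: measurable_last_below.
by move=> _ [x [_ [_ xL]] <-].
Qed.

End last_visit.

(** * Borel sets of a product *)

Lemma compact_metrizable_second_countable (R : realType) (T : ptopologicalType) :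
  compact [set: T] -> metrizable R T -> @second_countable T.
Proof.
(* The base consists of the balls in finite covers by balls of radius [n.+1%:R^-1], one cover for
   each [n]. *)
move=> cT [d [d0 dE dC dT dO]].
pose f n (z : T) : set T := [set y | d z y < n.+1%:R^-1].
have fx n z : f n z z by rewrite /f /= (dE z z).2.
have fo n z : open (f n z).
  apply/dO => x xz; exists (n.+1%:R^-1 - d z x); first by rewrite subr_gt0.
  move=> y /= xy; rewrite /f /= (le_lt_trans (dT z x y))//.
  by rewrite addrC -ltrBrDr.
have h n : finite_subset_cover [set: T] (f n) [set: T].
  by move: cT; rewrite compact_cover; apply=> // z _; exists z.
pose h' n := cid (iffLR (exists2P _ _) (h n)).
pose S n := projT1 (h' n).
exists (\bigcup_n (f n) @` [set` S n]); [|split].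
- apply: bigcup_countable => // n _; apply: finite_set_countable.
  exact/finite_image/finite_fset.
- by move=> _ [n _ [z _ <-]]; exact: fo.
- move=> x V; rewrite nbhsE => -[U [/dO oU Ux] UV].
  have [e e0 eU] := oU _ Ux.
  have [//|N] := @ltr_add_invr R 0 (e / 2) _; first by rewrite divr_gt0.
  rewrite add0r => Ne.
  have [w wS wx] : exists2 w : T, w \in S N & f N w x.
    by have [_ /(_ x) [//|w ? ?]] := projT2 (h' N); exists w.
  exists (f N w); first by split=> //; exists N => //; exists w.
  move=> y wy; apply/UV/eU => /=; rewrite (le_lt_trans (dT x w y))//.
  by rewrite [e]splitr ltrD// ?(dC x w); exact: lt_trans Ne.
Qed.

(** The maps [i1] and [i2] let the measurable and the topological structure sit on different types,
    as for [borel_of Om] and [Om]. *)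
Lemma open_prod_measurable (d1 d2 : measure_display) (T1 : measurableType d1)
    (T2 : measurableType d2) (U1 U2 : topologicalType)
    (i1 : T1 -> U1) (i2 : T2 -> U2) :
  @second_countable U1 ->
  (forall A : set U1, open A -> measurable (i1 @^-1` A)) ->
  (forall A : set U2, open A -> measurable (i2 @^-1` A)) ->
  forall O : set (U1 * U2), open O ->
  measurable [set x : T1 * T2 | O (i1 x.1, i2 x.2)].
Proof.
move=> [B cB [oB bB]] m1 m2 O oO.
(* [I A] is the largest open set whose product with [A] lies in [O]. Thus [O] is the union of the
   rectangles with sides [A] and [I A], over the countably many base sets [A]. *)
pose I (A : set U1) := \bigcup_(J in [set J | open J /\ A `*` J `<=` O]) J.
have oI A : open (I A) by apply: bigcup_open => J [].
rewrite [X in measurable X](_ : _ =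
    \bigcup_(A in B) ((i1 @^-1` A) `*` (i2 @^-1` (I A)))); last first.
  apply/seteqP; split=> [[x1 x2] /= Ox|[x1 x2] [A BA [/= Ax [J [oJ AJ] Jx]]]].
    have : nbhs (i1 x1, i2 x2) O by exact: open_nbhs_nbhs.
    move=> [[N1 N2] /= [nN1 nN2] NO].
    have [A [BA Ax] AN] := bB _ _ nN1.
    exists A => //; split=> //=.
    move: nN2; rewrite nbhsE => -[J [oJ Jx] JN]; exists J => //; split=> //.
    by move=> [a b] [/= Aa Jb]; apply: NO; split; [exact: AN|exact: JN].
  by apply: AJ.
case/pfcard_geP: cB => [->|[g]]; first by rewrite bigcup_set0.
have -> : B = g @` setT.
  by rewrite (surj_image_eq _ (@surj _ _ _ _ g))//; exact: fun_image_sub.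
rewrite bigcup_image; apply: bigcup_measurable => k Sk.
by apply: measurableX; [exact/m1/oB/funS|exact: m2].
Qed.

(** * Null sets of a product measure *)

Section product_null.
Context (d1 d2 : measure_display) (T1 : measurableType d1)
  (T2 : measurableType d2) (R : realType).
Local Open Scope ereal_scope.

Lemma measurable_nonnull_xsection (m2 : {sigma_finite_measure set T2 -> \bar R})
    (A : set (T1 * T2)) :
  measurable A -> measurable [set x | m2 (xsection A x) != 0].
Proof.
move=> mA; rewrite -[X in measurable X]setTI.
apply: (measurable_neqe measurableT (g := cst 0)) => //.
exact: measurable_fun_xsection.
Qed.

(** The product measure integrates the measures of the sections, and a non-negative integral
    vanishes exactly when its integrand does almost everywhere. *)
Lemma product_measure1_eq0P (m1 : {measure set T1 -> \bar R})
    (m2 : {sigma_finite_measure set T2 -> \bar R}) (A : set (T1 * T2)) :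
  measurable A ->
  (m1 \x m2) A = 0 <-> m1 [set x | m2 (xsection A x) != 0] = 0.
Proof.
move=> mA; have mN := measurable_nonnull_xsection m2 mA.
have mx := measurable_fun_xsection m2 mA.
have -> : (m1 \x m2) A = \int[m1]_(x in setT) `|(m2 \o xsection A) x|.
  by apply: eq_integral => x _; rewrite gee0_abs.
split=> [/(ae_eq_integral_abs m1 measurableT mx) N0|N0].
  apply: (measure_negligible mN); apply: negligibleS N0 => x /= /eqP xN.
  by move=> /(_ I).
apply/(ae_eq_integral_abs m1 measurableT mx).
apply: (@negligibleS _ _ _ _ [set x | m2 (xsection A x) != 0]).
  by move=> x /= xN; apply/eqP => x0; apply: xN.
exact/negligibleP.
Qed.

Lemma product_measure1_eq0_ysection (m1 : {sigma_finite_measure set T1 -> \bar R})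
    (m2 : {sigma_finite_measure set T2 -> \bar R}) (A : set (T1 * T2)) :
  measurable A -> (forall y, m1 (ysection A y) = 0) -> (m1 \x m2) A = 0.
Proof.
move=> mA A0.
(* Uniqueness of the product measure exchanges the order of integration. *)
rewrite (@product_measure_unique _ _ _ _ _ m1 m2 (m1 \x^ m2))//.
- by apply: integral0_eq => y _; exact: A0.
- by move=> ? ? ? ?; exact: product_measure2E.
Qed.

Lemma product_measure1_le_xsection (m1 : probability T1 R)
    (m2 : {sigma_finite_measure set T2 -> \bar R}) (A : set (T1 * T2)) (e : R) :
  measurable A -> (forall x, m2 (xsection A x) <= e%:E) -> (m1 \x m2) A <= e%:E.
Proof.
move=> mA Ae; apply: (@le_trans _ _ (\int[m1]_x (cst e%:E x))).
  apply: ge0_le_integral => //; first exact: measurable_fun_xsection.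
  by move=> x _; exact: Ae.
rewrite integral_cst// [X in (_ * X)%E](_ : _ = 1) ?mule1//.
exact: probability_setT.
Qed.

End product_null.

Lemma lebesgue_measure_le_diameter (R : realType) (S : set R) (e : R) :
  measurable S -> 0 <= e ->
  (forall r s, S r -> S s -> r <= s -> s - r <= e) ->
  (lebesgue_measure S <= e%:E)%E.
Proof.
move=> mS e0 Se; have [->|/set0P [x Sx]] := eqVneq S set0.
  by rewrite measure0 lee_fin.
have Slb : has_lbound S.
  exists (x - e) => y Sy; have [xy|/ltW yx] := leP x y.
    by rewrite (le_trans _ xy)// lerBlDr lerDl.
  by rewrite lerBlDr addrC -lerBlDr; exact: Se.
(* A set of diameter at most [e] fits in an interval of length [e] starting at its infimum. *)
apply: (@le_trans _ _ (lebesgue_measure (`[inf S, inf S + e] : set R))).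
  apply: le_measure; rewrite ?inE//.
  move=> y Sy; rewrite /= in_itv /= ge_inf//= -lerBlDr.
  apply: lb_le_inf; first by exists x.
  move=> z Sz; have [zy|/ltW yz] := leP z y.
    by rewrite lerBlDr addrC -lerBlDr; exact: Se.
  by rewrite (le_trans _ yz)// lerBlDr lerDl.
rewrite lebesgue_measure_itv /= lte_fin; case: ifP => _; last by rewrite lee_fin.
by rewrite -EFinD lee_fin addrAC subrr add0r.
Qed.

Lemma measurable_fun_borel_prod (R : realType) (Om : topologicalZmodType)
    (d : measure_display) (T : measurableType d) (D : set T)
    (g : T -> borel_of Om * measurableTypeR R) :
  (forall A : set Om, open A -> measurable (D `&` [set x | A (g x).1])) ->
  (forall J : set R, open J -> measurable (D `&` [set x | J (g x).2])) ->
  measurable_fun D g.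
Proof.
move=> g1 g2.
have mg1 : measurable_fun D (fst \o g).
  apply: (@measurability _ _ T (borel_of Om) D (fst \o g) (@open (gpt Om)) erefl).
  move=> _ [A oA <-].
  exact: g1.
have mg2 : measurable_fun D (snd \o g).
  apply: (measurability _ (RGenOpens.measurableE R)) => _ [_ [a [b ->] <-]].
  by apply: g2; exact: interval_open.
move=> mD; apply: (measurability _ (measurable_prod_measurableType _ _)) => //.
move=> _ [_ [A mA [J mJ <-]] <-].
rewrite [X in measurable X](_ : _ = (D `&` (fst \o g) @^-1` A) `&`
  (D `&` (snd \o g) @^-1` J)); first by apply: measurableI; [exact: mg1|exact: mg2].
by apply/seteqP; split=> [x [? [? ?]]|x [[? ?] [? ?]]].
Qed.

(** * Height functions and orbits in a compact group *)

Lemma derive1_bounds_increment (R : realType) (V : R -> R) (beta delta : R) :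
  (forall r, 0 < r -> derivable V r 1) ->
  (forall r, 0 < r -> beta <= derive1 V r <= delta) ->
  forall r s, 0 < r -> r <= s -> beta * (s - r) <= V s - V r <= delta * (s - r).
Proof.
move=> dV bV r s r0 rs.
have pos x : x \in `[r, s] -> 0 < x.
  by rewrite in_itv /= => /andP[rx _]; exact: lt_le_trans rx.
have [||c crs ->] := @MVT_segment R V (derive1 V) r s rs.
- move=> x xrs; rewrite derive1E; apply: derivableP; apply/dV/pos.
  exact: subset_itv_oo_cc.
- by apply: derivable_within_continuous => x xrs; exact/dV/pos.
- have /andP[bc cd] := bV c (pos _ crs).
  by rewrite !ler_wpM2r// subr_ge0.
Qed.

(** [W] is continuous in each variable separately; the Lipschitz bound in [r], uniform in [w],
    upgrades this to joint upper semicontinuity. *)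
Lemma open_sublevel (R : realType) (T : topologicalType) (W : T -> R -> R)
    (delta h : R) :
  (forall r, 0 < r -> continuous (W^~ r)) ->
  (forall w r s, 0 < r -> r <= s -> 0 <= W w s - W w r <= delta * (s - r)) ->
  open [set p : T * R | 0 < p.2 /\ W p.1 p.2 < h].
Proof.
move=> cW lW; rewrite openE => -[w0 r0] /= [r0_gt0 Wh].
(* Half of the gap below [h] is spent on moving [w], the other half on moving [r]. *)
pose e := (h - W w0 r0) / 2.
have e_gt0 : 0 < e by rewrite divr_gt0// subr_gt0.
pose c := `|delta| + 1.
have c_gt0 : 0 < c by rewrite ltr_wpDl.
have nW : \forall w \near w0, `|W w0 r0 - W w r0| < e.
  by have /cvgrPdist_lt := cW r0 r0_gt0 w0; exact.
(* The bound [r0] keeps [r] positive; [e / c] keeps the increase of [W] in [r] below [e]. *)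
have nr : \forall r \near r0, `|r0 - r| < Num.min r0 (e / c).
  have /cvgrPdist_lt : r @[r --> r0] --> r0 by exact: cvg_id.
  by apply; rewrite lt_min r0_gt0 divr_gt0.
rewrite /interior /=.
exists ([set w | `|W w0 r0 - W w r0| < e], [set r | `|r0 - r| < Num.min r0 (e / c)]).
  by split.
move=> [w r] /= [Ww]; rewrite lt_min => /andP[rr0 rc].
have r_gt0 : 0 < r by move: rr0; rewrite ltr_distlC addrN => /andP[].
split=> //.
have Wr : W w r <= W w r0 + e.
  have [r0r|/ltW rr] := leP r0 r; last first.
    have /andP[+ _] := lW w _ _ r_gt0 rr.
    by rewrite subr_ge0 => /le_trans; apply; rewrite lerDl ltW.
  have /andP[_] := lW w _ _ r0_gt0 r0r; rewrite lerBlDl => /le_trans; apply.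
  rewrite lerD2l; move: rc; rewrite distrC ger0_norm ?subr_ge0// => rc.
  apply: (@le_trans _ _ (c * (r - r0))).
    by rewrite ler_wpM2r ?subr_ge0// (le_trans (ler_norm _))// lerDl ler01.
  by rewrite mulrC -ler_pdivlMr// ltW.
rewrite (le_lt_trans Wr)//; move: Ww; rewrite ltr_distlC => /andP[_ Ww].
have -> : h = W w0 r0 + e + e by rewrite -addrA -splitr addrC subrK.
by rewrite ltrD2r.
Qed.

Section compact_group.
Context (R : realType) (Om : topologicalZmodType).
Hypothesis Om_compact : compact [set: Om].
Hypothesis Om_metrizable : metrizable R Om.

Lemma open_borel_prod_measurable (O : set (Om * R)) : open O ->
  measurable (O : set (borel_of Om * measurableTypeR R)%type).
Proof.
move=> oO; rewrite [X in measurable X](_ : _ =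
  [set x : borel_of Om * measurableTypeR R | O (id x.1 : Om, id x.2 : R)]).
  apply: (@open_prod_measurable _ _ (borel_of Om) (measurableTypeR R) (gpt Om) R
    id id _ _ _ O oO) => [|A oA|A oA].
  - exact: (@compact_metrizable_second_countable R (gpt Om)).
  - exact: sub_sigma_algebra.
  - exact: open_measurable.
by apply/seteqP; split=> [[]|[]].
Qed.

Lemma within_continuous_measurable_preimage (D : set (Om * R))
    (g : Om * R -> Om * R) : open D -> {within D, continuous g} ->
  forall B : set (borel_of Om * measurableTypeR R)%type, measurable B ->
  measurable (D `&` g @^-1` B : set (borel_of Om * measurableTypeR R)%type).
Proof.
move=> oD; rewrite (continuous_open_subspace g oD) => cg.
have oDg (O : set (Om * R)) : open O -> open (D `&` g @^-1` O).
  rewrite !openE => oO x [Dx Ox]; apply: filterI.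
    by move: oD; rewrite openE; exact.
  by apply: cg; [rewrite inE|exact: oO].
have mg : @measurable_fun _ _ (borel_of Om * measurableTypeR R)%type
    (borel_of Om * measurableTypeR R)%type D g.
  apply: measurable_fun_borel_prod => [A oA|J oJ].
    apply: open_borel_prod_measurable; apply: (oDg (fst @^-1` A)).
    by apply: open_comp => // x _; exact: cvg_fst.
  apply: open_borel_prod_measurable; apply: (oDg (snd @^-1` J)).
  by apply: open_comp => // x _; exact: cvg_snd.
by move=> B mB; apply: mg => //; exact: open_borel_prod_measurable.
Qed.

Context (psi : R -> Om).
Hypothesis psi_cont : continuous psi.

Lemma continuous_translate_orbit : continuous (fun p : Om * R => p.1 + psi p.2).
Proof.
move=> p.
apply: (@continuous2_cvg _ _ _ _ _ _ fst (psi \o snd) (fun x y : Om => x + y)).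
- exact: (@add_continuous Om (p.1, psi p.2)).
- exact: cvg_fst.
- by apply: continuous_cvg; [exact: psi_cont|exact: cvg_snd].
Qed.

Lemma measurable_translate_orbit (N : set (borel_of Om)) : measurable N ->
  measurable ([set p | N (p.1 + psi p.2 : Om)] :
    set (borel_of Om * measurableTypeR R)%type).
Proof.
move=> mN; rewrite -[X in measurable X]setTI.
pose g (p : borel_of Om * measurableTypeR R) : borel_of Om := p.1 + psi p.2 : Om.
suff mg : measurable_fun setT g by exact: mg.
apply: (@measurability _ _ (borel_of Om * measurableTypeR R)%type (borel_of Om)
  setT g (@open (gpt Om)) erefl) => _ [A oA <-]; rewrite setTI.
apply: open_borel_prod_measurable.
by apply: open_comp => // p _; exact: continuous_translate_orbit.
Qed.

Lemma measurable_orbit_slice (w : Om) (E : set (borel_of Om * measurableTypeR R)%type) :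
  measurable E -> measurable ([set p | E (w + psi p.1 : Om, p.2)] :
    set (measurableTypeR R * measurableTypeR R)%type).
Proof.
move=> mE; rewrite -[X in measurable X]setTI.
pose g (p : measurableTypeR R * measurableTypeR R) :
  borel_of Om * measurableTypeR R := (w + psi p.1 : Om, p.2).
suff mg : measurable_fun setT g by exact: mg.
have mfst (A : set R) : open A ->
    measurable ([set p | A p.1] : set (measurableTypeR R * measurableTypeR R)%type).
  move=> oA; rewrite -[X in measurable X]setTI.
  by apply: (@measurable_fst _ _ (measurableTypeR R) (measurableTypeR R)) => //;
    exact: open_measurable.
apply: measurable_fun_borel_prod => [A oA|J oJ]; rewrite setTI.
  apply: (mfst [set t | A (w + psi t)]).
  apply: open_comp => // t _.
  apply: (@continuous2_cvg _ _ _ _ _ _ (cst w) psi (fun x y : Om => x + y)).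
  - exact: (@add_continuous Om (w, psi t)).
  - exact: cvg_cst.
  - exact: psi_cont.
rewrite -[X in measurable X]setTI.
by apply: (@measurable_snd _ _ (measurableTypeR R) (measurableTypeR R)) => //;
  exact: open_measurable.
Qed.

(** Tonelli is applied three times: to [E], giving a null set [N] of base points with non-null
    section; to [S], the pairs [(w, t)] with [w + psi t] in [N]; and to the slice of [E] along the
    orbit of [w]. *)
Lemma null_orbit_slices (mu : probability (borel_of Om) R)
    (E : set (borel_of Om * measurableTypeR R)%type) :
  haar_probability mu -> measurable E -> (mu \x lebesgue_measure)%E E = 0%E ->
  {ae mu, forall w : borel_of Om,
    (lebesgue_measure \x lebesgue_measure)%E
      [set p : R * R | E ((w : Om) + psi p.1, p.2)] = 0%E}.
Proof.
move=> haar mE E0.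
pose lam : {sigma_finite_measure set (measurableTypeR R) -> \bar R} := lebesgue_measure.
pose N : set (borel_of Om) := [set w | lam (xsection E w) != 0%E].
have mN : measurable N := measurable_nonnull_xsection lam mE.
have N0 : mu N = 0%E by exact/(product_measure1_eq0P mu lam mE).
pose S : set (borel_of Om * measurableTypeR R)%type :=
  [set p | N (p.1 + psi p.2 : Om)].
have mS : measurable S := measurable_translate_orbit mN.
have S0 : (mu \x lam)%E S = 0%E.
  apply: product_measure1_eq0_ysection => // t.
  (* Translating the section of [S] at time [t] by [psi t] gives back [N], so Haar invariance makes
     the section null. *)
  apply: (eq_trans (esym (haar (psi t) (ysection S t) (measurable_ysection t mS)))).
  rewrite -[RHS]N0; congr (mu _); apply/seteqP; split=> [_ [w + <-]|w Nw].
    by rewrite /ysection /= inE /S /= addrC.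
  exists (w - psi t : Om); last by rewrite addrC subrK.
  by rewrite /ysection /= inE /S /= subrK.
have mM := measurable_nonnull_xsection lam mS.
exists [set w | lam (xsection S w) != 0%E]; split=> //.
  exact/(product_measure1_eq0P mu lam mS).
move=> w /= wE; apply/eqP => wS; apply: wE.
have mEw := measurable_orbit_slice w mE.
(* The times at which the slice has a non-null section form exactly the section of [S] at [w]. *)
apply/(product_measure1_eq0P lam lam mEw).
rewrite -[RHS]wS; congr (lam _); apply/seteqP; split=> t;
  by rewrite !xsectionE /S /N /= !xsectionE.
Qed.

End compact_group.

(** * Level crossings of an orbit *)

(** As [psi] is additive, the planar map is a lift of the flow map along the orbit of [w]; hence
    planar orbits project to orbits in the product. *)
Lemma iter_flowmap_orbit (R : realType) (Om : topologicalZmodType) (psi : R -> Om)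
    (F G : Om * R -> R) (w : Om) (p : R * R) (n : nat) :
  {morph psi : x y / x + y} ->
  iter n (flowmap psi F G) (w + psi p.1, p.2) =
  (w + psi (iter n (ffib psi F G w) p).1, (iter n (ffib psi F G w) p).2).
Proof.
move=> psiD; elim: n => //= n ->.
by rewrite /flowmap /ffib /= psiD addrA.
Qed.

Section height.
Context (R : realType) (Om : topologicalZmodType) (W : Om -> R -> R).
Context (beta delta : R).
Hypotheses (beta_gt0 : 0 < beta) (delta_gt0 : 0 < delta).
Hypothesis W_incr : forall w r s, 0 < r -> r <= s ->
  beta * (s - r) <= W w s - W w r <= delta * (s - r).

Lemma height_le (C : R) : (forall w, W w 1 <= C) ->
  forall w r, 0 < r -> W w r <= C + delta * r.
Proof.
move=> WC w r r0; have [r1|/ltW r1] := leP 1 r.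
  have /andP[_] := W_incr w ltr01 r1; rewrite lerBlDl => /le_trans; apply.
  by apply: lerD => //; rewrite ler_wpM2l ?(ltW delta_gt0)// gerBl ler01.
have /andP[+ _] := W_incr w r0 r1.
have : 0 <= beta * (1 - r) by rewrite mulr_ge0 ?subr_ge0// ltW.
move=> /le_trans /[apply]; rewrite subr_ge0 => /le_trans; apply.
by rewrite (le_trans (WC w))// lerDl mulr_ge0// ltW.
Qed.

Lemma height_ge (c : R) : (forall w, c <= W w 1) ->
  forall w r, 1 <= r -> c + beta * (r - 1) <= W w r.
Proof.
move=> cW w r r1; have /andP[+ _] := W_incr w ltr01 r1.
by rewrite lerBrDl; apply: le_trans; rewrite lerD2r.
Qed.

(** Over a fixed [w], two radii in the strip differ in height by at most [beta * e], hence in radius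
    by at most [e]; and [mu] has total mass one. *)
Lemma measure_height_strip (mu : probability (borel_of Om) R)
    (A : set (borel_of Om * measurableTypeR R)%type) (h e : R) :
  0 <= e -> measurable A ->
  (forall w r, A (w, r) -> 0 < r /\ h - beta * e <= W w r < h) ->
  ((mu \x lebesgue_measure) A <= e%:E)%E.
Proof.
move=> e0 mA AW; apply: product_measure1_le_xsection => // w.
apply: lebesgue_measure_le_diameter => //; first exact: measurable_xsection.
move=> r s; rewrite !xsectionE /= => /AW [r0 /andP[hr _]] /AW [_ /andP[_ sh]] rs.
rewrite -(ler_pM2l beta_gt0); have /andP[+ _] := W_incr w r0 rs.
move=> /le_trans; apply; rewrite lerBlDr (le_trans (ltW sh))// addrC -lerBlDr.
exact: hr.
Qed.

Lemma thin_level_crossing (mu : probability (borel_of Om) R) (D : set (Om * R))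
    (f : Om * R -> Om * R) (k : R -> R) (C : R) :
  (forall w, W w 1 <= C) -> D `<=` [set p | 0 < p.2] ->
  (exists M : R, forall r : R, 0 < r -> `|k r| <= M) ->
  k x @[x --> +oo] --> 0 ->
  (forall p, D p -> W (f p).1 (f p).2 <= W p.1 p.2 + k p.2) ->
  forall e, 0 < e -> exists H : R, forall h, H <= h ->
  forall A : set (borel_of Om * measurableTypeR R)%type, measurable A ->
    A `<=` D `&` [set p | W p.1 p.2 < h <= W (f p).1 (f p).2] ->
  ((mu \x lebesgue_measure) A <= e%:E)%E.
Proof.
move=> WC Dpos [M kM] k0 Wf e e0.
have be0 : 0 < beta * e by rewrite mulr_gt0.
have /cvgrPdist_lt /(_ _ be0) [K [_ Kk]] := k0.
(* A crossing of [h] at radius [r] forces [h <= W w r + M <= C + delta * r + M]. This level thus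
   forces [K < r], where [k r] is below [beta * e]; the summand [1] makes the inequality strict. *)
exists (M + C + delta * K + 1) => h Hh A mA AD.
apply: (@measure_height_strip mu A h) => //; first exact: ltW.
move=> w r /AD [Dp /= /andP[Wh hW]]; have r0 := Dpos _ Dp; split=> //.
rewrite Wh andbT lerBlDr.
have hk := le_trans hW (Wf _ Dp); rewrite /= in hk.
apply: (le_trans hk); rewrite lerD2l.
have /Kk : K < r.
  rewrite -(@ltr_pM2l _ delta)// -(ltrD2l C).
  apply: (lt_le_trans _ (height_le WC w r0)).
  rewrite -(ltrD2l M) addrA; apply: (@lt_le_trans _ _ h).
    by apply: lt_le_trans Hh; rewrite ltrDl ltr01.
  apply: (le_trans hk); rewrite addrC lerD2r.
  exact: le_trans (ler_norm _) (kM _ r0).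
by rewrite sub0r normrN => /ltW; exact: le_trans (ler_norm _).
Qed.

End height.

(** * Null escaping sets in almost every fibre *)

Theorem theorem3p1 (R : realType) (Om : topologicalZmodType)
  (hcomp : compact [set: Om]) (hmetr : metrizable R Om)
  (psi : R -> Om) (hpsi_cont : continuous psi)
  (hpsi_add : {morph psi : x y / x + y}) (hpsi_dense : dense (range psi))
  (mu : probability (borel_of Om) R) (hmu : haar_probability mu)
  (D : set (Om * R)) (hDopen : open D) (hDpos : D `<=` [set p | 0 < p.2])
  (F G : Om * R -> R)
  (hF : {within D, continuous F}) (hG : {within D, continuous G})
  (hfcont : {within D, continuous (flowmap psi F G)})
  (hfinj : {in D &, injective (flowmap psi F G)})
  (hfpos : flowmap psi F G @` D `<=` [set p | 0 < p.2])
  (hfmp : forall B : set (borel_of Om * R)%type, measurable B -> B `<=` D ->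
     measurable (flowmap psi F G @` B : set (borel_of Om * R)%type) /\
     (mu \x lebesgue_measure)%E (flowmap psi F G @` B : set (borel_of Om * R)%type)
       = (mu \x lebesgue_measure)%E B)
  (W : Om -> R -> R) (hW : C1psi_half psi W) (beta delta : R)
  (hbeta : 0 < beta) (hdelta : 0 < delta)
  (hWr : forall (w : Om) (r : R), 0 < r -> beta <= derive1 (W w) r <= delta)
  (k : R -> R)
  (hk_dec : forall r s : R, 0 < r -> r <= s -> k s <= k r)
  (hk_bnd : exists M : R, forall r : R, 0 < r -> `|k r| <= M)
  (hk_lim : k x @[x --> +oo] --> 0)
  (hWf : forall p : Om * R, D p ->
     W (flowmap psi F G p).1 (flowmap psi F G p).2 <= W p.1 p.2 + k p.2) :
  {ae mu, forall w : borel_of Om,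
     (lebesgue_measure \x lebesgue_measure)%E.-negligible
        (escaping psi D F G (w : Om))}.
Proof.
have W_incr w := derive1_bounds_increment (hW.2 w).1 (hWr w).
have W_cont r : 0 < r -> continuous (W^~ r) by move=> r0; case: (hW.1 r r0).
have Om0 : [set: Om] !=set0 by exists 0.
(* Compactness bounds [W] at radius [1] uniformly in [w]; with the increments in [r], this makes
   height and radius comparable. *)
have W1_cont : {within [set: Om], continuous (W^~ 1)}.
  exact/continuous_subspaceT/W_cont.
have [wmax _ Wmax] := compact_EVT_max Om0 hcomp W1_cont.
have [wmin _ Wmin] := compact_EVT_min Om0 hcomp W1_cont.
have W_le w : W w 1 <= W wmax 1 by apply: Wmax; rewrite inE.
have W_ge w : W wmin 1 <= W w 1 by apply: Wmin; rewrite inE.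
pose T := (borel_of Om * measurableTypeR R)%type.
pose m : {measure set T -> \bar R} := (mu \x lebesgue_measure)%E.
pose V (p : T) : R := W p.1 p.2.
pose f : T -> T := flowmap psi F G.
pose DT : set T := D.
have mD : measurable DT by exact: open_borel_prod_measurable.
have mV h : measurable (DT `&` [set x | V x < h]).
  (* Positivity of the radius holds throughout [D]; writing it out exhibits the set as an
     intersection of two open sets. *)
  rewrite [X in measurable X](_ : _ =
      (D `&` [set p | 0 < p.2 /\ W p.1 p.2 < h] : set T)).
    apply: open_borel_prod_measurable => //; apply: openI => //.
    apply: (@open_sublevel _ _ _ delta) => // w r s r0 rs.
    have /andP[Wl ->] := W_incr w r s r0 rs; rewrite andbT.
    by rewrite (le_trans _ Wl)// mulr_ge0 ?subr_ge0// ltW.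
  apply/seteqP; split=> p [Dp] => [Vp|[_ Vp]]; split=> //.
  by split; [exact: hDpos|exact: Vp].
have mf (B : set T) : measurable B -> measurable (DT `&` f @^-1` B).
  exact: (within_continuous_measurable_preimage hcomp hmetr hDopen hfcont).
have thin := thin_level_crossing hbeta hdelta W_incr mu W_le hDpos hk_bnd hk_lim hWf.
have mE : measurable (unbounded_escape DT f V) by exact: measurable_unbounded_escape.
have E0 : m (unbounded_escape DT f V) = 0%E.
  exact: (@unbounded_escape_null _ _ _ m DT f V mD mf hfinj hfmp mV thin).
have [N [mN N0 NE]] := null_orbit_slices hcomp hmetr hpsi_cont hmu mE E0.
exists N; split=> // w wE; apply: NE => /= w0; apply: wE.
(* The null slice covers the escaping set of the fibre: radii tending to infinity force heights to
   do so. *)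
exists [set p | unbounded_escape DT f V ((w : Om) + psi p.1, p.2)]; split=> //.
  exact: (measurable_orbit_slice hpsi_cont w mE).
move=> p [pD pr].
have fE n := iter_flowmap_orbit F G w p n hpsi_add.
split=> [n|h]; first by rewrite /f fE; exact: pD.
(* This solves [W wmin 1 + beta * (r - 1) >= h%:R], with [r >= 1] as [height_ge] requires. *)
pose r := Num.max 1 ((h%:R - W wmin 1) / beta + 1).
have [n0 _ n0r] := (cvgryPge _).1 pr r.
exists n0 => n n0n; rewrite /f fE /V /=.
have := n0r n n0n; rewrite /= ge_max => /andP[rn1 rnh].
apply: le_trans (height_ge W_incr W_ge _ rn1).
by rewrite -lerBlDl mulrC -ler_pdivrMr// lerBrDr.
Qed.
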